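(* For integers $n\ge 0$ let $f'(n)=\#\{k\ge 1 : n+k\equiv 0 \pmod{2^k}\}$, and for $n\ge 1$ let $f(n)=\#\{k : 1\le k\le n,\ k\equiv n\pmod{2^k}\}$. Then $f'(0)=0$, $f'(1)=1$, and for all integers $i\ge 1$ and $0\le j\le 2^i-1$, $$ f'(2^i+j)=\begin{cases} f'(j)+1 & \text{if } j=2^i-i-1,\\ f'(j) & \text{otherwise}.\end{cases} $$ Moreover $f'(2^n-n)=f(n)$ for all $n\ge 1$.
   Context: The set defining $f'(n)$ is finite, since $n+k\equiv 0\pmod{2^k}$ with $n\ge 0$, $k\ge1$ forces $n+k\ge 2^k$. *)

(* Defs.v *)
From mathcomp Require Import all_boot finmap.
From mathcomp Require Import boolp classical_sets functions cardinality.

Set Implicit Arguments.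
Unset Strict Implicit.
Unset Printing Implicit Defensive.

Definition fprime_set (n : nat) : set nat :=
  [set k : nat | 1 <= k /\ n + k = 0 %[mod 2 ^ k]]%classic.

Definition f_set (n : nat) : set nat :=
  [set k : nat | 1 <= k <= n /\ k = n %[mod 2 ^ k]]%classic.

(* [fset_set] is a junk value (the empty finite set) on infinite sets; the two
   lemmas below show that this case never occurs here. *)
Definition fprime (n : nat) : nat := #|` fset_set (fprime_set n)|.

Definition f (n : nat) : nat := #|` fset_set (f_set n)|.

Lemma finite_fprime_set (n : nat) : finite_set (fprime_set n).
Proof.
apply: (sub_finite_set _ (finite_II n.+2)) => k [k_gt0 nk] /=.
have dvd : 2 ^ k %| n + k by apply/eqP; rewrite nk mod0n.
have le_nk : 2 ^ k <= n + k by apply: dvdn_leq dvd; rewrite addn_gt0 k_gt0 orbT.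
have lt2 m : m.*2 < 2 ^ m.+1 by rewrite expnS mul2n ltn_double ltn_expl.
case: k k_gt0 le_nk {nk dvd} => // k _ le_nk.
have := leq_trans (lt2 k) le_nk.
by rewrite -addnn addnS ltnS leq_add2r.
Qed.

Lemma finite_f_set (n : nat) : finite_set (f_set n).
Proof.
by apply: (sub_finite_set _ (finite_II n.+1)) => k [/andP[_ k_le_n] _].
Qed.

(* Main.v *)
Require Import Defs.
From mathcomp Require Import all_boot finmap zify.
From mathcomp Require Import classical_sets cardinality.

(* A multiple of 2^k that is positive is at least 2^k, so large k never count.
   For j < 2^i this leaves k <= i + 1 in f'(2^i + j) and k <= i in f'(j). For
   k <= i the two congruences coincide because 2^k divides 2^i, and k = i + 1
   counts for 2^i + j exactly when j + i + 1 = 2^i. In the same way only k <= n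
   count for 2^n - n, and for them 2^n - n + k = k - n mod 2^k. *)

Lemma fprime_setE (n k : nat) :
  fprime_set n k <-> 0 < k /\ 2 ^ k %| n + k.
Proof.
by split=> -[k_gt0 nk]; split=> //; apply/eqP; rewrite ?mod0n // nk mod0n.
Qed.

Lemma fprime_setN (n k : nat) : n + k < 2 ^ k -> ~ fprime_set n k.
Proof. by move=> lt_nk /fprime_setE[k_gt0]; rewrite gtnNdvd //; lia. Qed.

Lemma fprime_set0 : fprime_set 0 = set0.
Proof.
by apply/seteqP; split=> // k; apply: fprime_setN; rewrite add0n ltn_expl.
Qed.

Lemma fprime_set1 : fprime_set 1 = [set 1]%classic.
Proof.
apply/seteqP; split=> [[|[|k]]|k ->] //; first by case.
have : 1 + k.+2 < 2 ^ k.+2.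
  by have := ltn_expl k (isT : 1 < 2); rewrite !expnS; lia.
by move/fprime_setN=> notin /notin.
Qed.

Lemma fprime_set_add_expn_small (i j k : nat) :
  k <= i -> fprime_set (2 ^ i + j) k <-> fprime_set j k.
Proof.
by move=> le_ki; rewrite !fprime_setE -addnA dvdn_addr // dvdn_exp2l.
Qed.

(** Since [j < 2 ^ i] and [i.+1 <= 2 ^ i], the sum [2 ^ i + j + i.+1] is positive and below
    [2 * 2 ^ i.+1], so the quotient by [2 ^ i.+1] can only be 1. *)
Lemma fprime_set_add_expn_top (i j : nat) : j < 2 ^ i ->
  fprime_set (2 ^ i + j) i.+1 <-> j + i.+1 = 2 ^ i.
Proof.
move=> lt_j; have lt_i := ltn_expl i (isT : 1 < 2).
rewrite fprime_setE; split=> [[_ /dvdnP[[|[|q]]]]|eq_ji]; rewrite ?expnS; try nia.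
by split=> //; rewrite -addnA eq_ji addnn -mul2n.
Qed.

(** Add [2 ^ i + j + 1 <= 2 ^ i.+1 <= 2 ^ (k - 1)] and [k - 1 < 2 ^ (k - 1)]. *)
Lemma fprime_set_add_expn_large (i j k : nat) :
  j < 2 ^ i -> i.+1 < k -> ~ fprime_set (2 ^ i + j) k.
Proof.
case: k => // k lt_j lt_ik; apply: fprime_setN; rewrite expnS.
have : 2 ^ i.+1 <= 2 ^ k by rewrite leq_exp2l.
by have := ltn_expl k (isT : 1 < 2); rewrite expnS; lia.
Qed.

(** This bound serves twice: every member for [j] falls in the range where the congruences for [j]
    and [2 ^ i + j] coincide, and [i.+1] is a new element, so it raises the count by exactly one. *)
Lemma fprime_set_gtN (i j k : nat) : j < 2 ^ i -> i < k -> ~ fprime_set j k.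
Proof.
case: k => // k lt_j lt_ik; apply: fprime_setN; rewrite expnS.
have : 2 ^ i <= 2 ^ k by rewrite leq_exp2l.
by have := ltn_expl k (isT : 1 < 2); lia.
Qed.

Lemma fprime_set_add_expn (i j : nat) : j < 2 ^ i ->
  fprime_set (2 ^ i + j) =
    if j + i.+1 == 2 ^ i then (i.+1 |` fprime_set j)%classic
    else fprime_set j.
Proof.
move=> lt_j; apply/seteqP; split=> k.
  have [le_ki|gt_ki|->] := ltngtP k i.+1.
  - move/(fprime_set_add_expn_small i j k le_ki)=> jk.
    by case: eqP => // _; right.
  - by move/(fprime_set_add_expn_large _ _ _ lt_j gt_ki).
  - by move/(fprime_set_add_expn_top _ _ lt_j)=> ->; rewrite eqxx; left.
have small : fprime_set j k -> fprime_set (2 ^ i + j) k.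
  move=> jk; apply/fprime_set_add_expn_small => //; rewrite leqNgt.
  by apply/negP => /(fprime_set_gtN _ _ _ lt_j); apply.
by case: eqP => // top [->|//]; apply/fprime_set_add_expn_top.
Qed.

Lemma fprime_add_expn (i j : nat) : j < 2 ^ i ->
  fprime (2 ^ i + j) = fprime j + (j + i.+1 == 2 ^ i).
Proof.
move=> lt_j; rewrite /fprime fprime_set_add_expn //.
case: eqP => _; last by rewrite addn0.
have fin := finite_fprime_set j.
have notin : i.+1 \notin fset_set (fprime_set j).
  rewrite in_fset_set //; apply/negP => /set_mem.
  exact: fprime_set_gtN lt_j (ltnSn i).
by rewrite fset_setU1 ?cardfsU1 ?notin 1?addnC.
Qed.

Lemma fprime_set_expn_sub (n : nat) : 0 < n -> fprime_set (2 ^ n - n) = f_set n.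
Proof.
move=> n_gt0; have lt_n := ltn_expl n (isT : 1 < 2).
apply/seteqP; split=> k.
  case: (leqP k n) => [le_kn|lt_nk] nk; last first.
    case: (fprime_setN _ _ _ nk).
    (* With [d = k - n > 0], the claim reads [2 ^ n + d < 2 ^ n * 2 ^ d]; it follows from
       [d < 2 ^ d] and [2 <= 2 ^ n]. *)
    have -> : 2 ^ k = 2 ^ n * 2 ^ (k - n) by rewrite -expnD subnKC // ltnW.
    by have := ltn_expl (k - n) (isT : 1 < 2); nia.
  case/fprime_setE: nk => k_gt0 dvd; split; first by rewrite k_gt0.
  apply/esym/eqP; rewrite eqn_mod_dvd //.
  (* The numbers [n - k] and [2 ^ n - n + k] add up to [2 ^ n], a multiple of [2 ^ k], so [2 ^ k]
     divides both or neither. *)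
  by rewrite -(dvdn_addl _ dvd) (_ : _ + _ = 2 ^ n) ?dvdn_exp2l //; lia.
case=> /andP[k_gt0 le_kn] /esym/eqP; rewrite eqn_mod_dvd // => dvd.
apply/fprime_setE; split=> //.
by rewrite -(dvdn_addl _ dvd) (_ : _ + _ = 2 ^ n) ?dvdn_exp2l //; lia.
Qed.

Theorem theorem7 :
  fprime 0 = 0 /\
  fprime 1 = 1 /\
  (forall i j : nat, 1 <= i -> 0 <= j <= 2 ^ i - 1 ->
    fprime (2 ^ i + j) =
      if j == 2 ^ i - i - 1 then fprime j + 1 else fprime j) /\
  (forall n : nat, 1 <= n -> fprime (2 ^ n - n) = f n).
Proof.
split; first by rewrite /fprime fprime_set0 fset_set0 cardfs0.
split; first by rewrite /fprime fprime_set1 fset_set1 cardfs1.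
split=> [i j _ le_j|n n_gt0]; last by rewrite /fprime fprime_set_expn_sub.
have lt_i := ltn_expl i (isT : 1 < 2).
rewrite fprime_add_expn; last by lia.
(* The truncated subtraction is exact here because [i < 2 ^ i]. *)
have -> : (j + i.+1 == 2 ^ i) = (j == 2 ^ i - i - 1) by lia.
by case: eqP; rewrite ?addn0.
Qed.
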